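(* Let $d,k\in\mathbb N$ with $1\le k\le d$ and let $t,s\in\mathbb N$. Let $D\subset G_{k,d}$ be a finite set with positive weights $\{\omega_V\}_{V\in D}$, and assume that $(D,\{\omega_V\})$ is a tight $t$-fusion frame. For each $V\in D$, let $Y_V\subset S(V)$ be a finite set with positive weights $\{\lambda_{V,z}\}_{z\in Y_V}$ such that $(Y_V,\{\lambda_{V,z}\}_{z\in Y_V})$ is a weighted spherical $s$-design on $S(V)$, and assume that $\Lambda:=\sum_{z\in Y_V}\lambda_{V,z}$ is independent of $V$. Define a weighted finite set $(Z,w)$ on $S^{d-1}$ by $$Z:=\bigcup_{V\in D}Y_V\subset S^{d-1},\qquad w(z):=\sum_{\substack{V\in D\\ z\in Y_V}}\omega_V\,\lambda_{V,z}\quad(z\in Z).$$ Then $(Z,w)$ is a weighted spherical $r$-design on $S^{d-1}$ with $r=\min\{s,\,2t+1\}$.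
   Context: $\mathbb N=\{1,2,\dots\}$. $S^{d-1}=\{x\in\mathbb R^d:\|x\|=1\}$ with normalized (probability) surface measure $\sigma$. $G_{k,d}$ is the set of $k$-dimensional linear subspaces of $\mathbb R^d$. For $V\in G_{k,d}$, $S(V)=\{x\in V:\|x\|=1\}\simeq S^{k-1}$, with its $O(V)$-invariant probability measure, and $P_V:\mathbb R^d\to\mathbb R^d$ is the orthogonal projection onto $V$. Tight $t$-fusion frame: a finite set $D\subset G_{k,d}$ with positive weights $\{\omega_V\}_{V\in D}$ such that there is a constant $A>0$ with $\sum_{V\in D}\omega_V\|P_Vx\|^{2t}=A\|x\|^{2t}$ for all $x\in\mathbb R^d$. Weighted spherical $t$-design on $S^{d-1}$: a finite set $X=\{x_1,\dots,x_n\}\subset S^{d-1}$ with positive weights $\lambda_1,\dots,\lambda_n$ such that for every polynomial function $f:\mathbb R^d\to\mathbb R$ of total degree at most $t$, $\int_{S^{d-1}}f\,d\sigma=\frac1\Lambda\sum_{j=1}^n\lambda_jf(x_j)$, where $\Lambda=\sum_j\lambda_j$. A weighted spherical $s$-design on $S(V)$ is defined in the same way after identifying $V$ isometrically with $\mathbb R^k$ (so $S(V)$ with $S^{k-1}$). *)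

(* Defs.v *)
From HB Require Import structures.
From mathcomp Require Import all_boot all_order all_algebra.
From mathcomp Require Import finmap.
From mathcomp Require Import -(notations) mpoly.
From mathcomp Require Import all_classical all_reals all_analysis.
From mathcomp Require Import measurable_realfun.

Set Implicit Arguments.
Unset Strict Implicit.
Unset Printing Implicit Defensive.

Import Order.TTheory GRing.Theory Num.Theory.
Import numFieldNormedType.Exports.

Local Open Scope classical_set_scope.
Local Open Scope ring_scope.

(* Points of R^n are row vectors 'rV[R]_n.  Measures on R^n live on n-tuples,
   for which the library provides the sigma-algebra generated by the
   coordinates, i.e. the Borel one; row_of_tuple identifies the two. *)
Notation Rtuple R n := (n.-tuple R).

Section lebesgue_tuple.
Context {R : realType}.

Definition tuple_cons n (p : R * Rtuple R n) :
  Rtuple R n.+1 := [tuple of p.1 :: p.2].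

Lemma measurable_tuple_cons n : measurable_fun setT (@tuple_cons n).
Proof. exact: measurable_cons. Qed.

Section cons.
Context {n : nat} (mu : {sigma_finite_measure set (Rtuple R n) -> \bar R}).

Definition lebesgue_cons :=
  pushforward (@lebesgue_measure R \x mu)%E (@tuple_cons n).

Let mcons := @measurable_tuple_cons n.

Let lebesgue_cons0 : lebesgue_cons set0 = 0%E.
Proof. by rewrite /lebesgue_cons /pushforward preimage_set0 measure0. Qed.

Let lebesgue_cons_ge0 A : (0 <= lebesgue_cons A)%E.
Proof. exact: measure_ge0. Qed.

Let lebesgue_cons_sigma_additive : semi_sigma_additive lebesgue_cons.
Proof. exact: measure_semi_sigma_additive. Qed.

HB.instance Definition _ := isMeasure.Build _ _ _ lebesgue_cons
  lebesgue_cons0 lebesgue_cons_ge0 lebesgue_cons_sigma_additive.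

Let lebesgue_cons_sigma_finite : sigma_finite setT lebesgue_cons.
Proof.
have /sigma_finiteP[F [FT ndF Foo]] := sigma_finiteT (@lebesgue_measure R).
have /sigma_finiteP[G [GT ndG Goo]] := sigma_finiteT mu.
pose H i := F i `*` G i.
have HT : setT = \bigcup_i H i.
  apply/esym; rewrite -subTset => -[x y] _.
  have [i _ Fx] : (\bigcup_i F i) x by rewrite -FT.
  have [j _ Gy] : (\bigcup_i G i) y by rewrite -GT.
  exists (maxn i j) => //; split => /=.
    by move: x Fx; exact/subsetPset/ndF/leq_maxl.
  by move: y Gy; exact/subsetPset/ndG/leq_maxr.
have Hoo i : measurable (H i) /\ ((@lebesgue_measure R \x mu) (H i) < +oo)%E.
  have [mF Fi] := Foo i; have [mG Gi] := Goo i.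
  split; first exact: measurableX.
  by rewrite product_measure1E// lte_mul_pinfty// ge0_fin_numE.
pose uncons (u : Rtuple R n.+1) : R * Rtuple R n :=
  (tnth u ord0, [tuple of behead u]).
have uncK : cancel (@tuple_cons n) uncons.
  move=> [x u]; congr pair.
  exact/val_inj.
have munc : measurable_fun setT uncons.
  apply/measurable_fun_pairP; split.
    exact: measurable_tnth.
  exact: measurable_behead.
exists (fun i => uncons @^-1` H i).
  by rewrite -preimage_bigcup -HT preimage_setT.
move=> i; have [mH Hi] := Hoo i; split.
  by rewrite -[X in measurable X]setTI; exact: munc.
rewrite /lebesgue_cons /pushforward -comp_preimage (_ : _ \o _ = id)//.
by apply/funext => p; exact: uncK.
Qed.

HB.instance Definition _ := Measure_isSigmaFinite.Build _ _ _ lebesgue_cons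
  lebesgue_cons_sigma_finite.
End cons.

(* The n-dimensional Lebesgue measure; R^0 is a point of mass 1. *)
Fixpoint lebesgue_tuple n : {sigma_finite_measure set (Rtuple R n) -> \bar R} :=
  match n with
  | 0 => \d_[tuple]
  | n.+1 => lebesgue_cons (lebesgue_tuple n)
  end.

End lebesgue_tuple.

(* The library's norm on 'rV[R]_n is the sup norm. *)
Definition dot (R : realType) n (x y : 'rV[R]_n) : R :=
  \sum_(i < n) x 0 i * y 0 i.

Definition enorm (R : realType) n (x : 'rV[R]_n) : R := Num.sqrt (dot x x).

Definition row_of_tuple (R : realType) n (u : Rtuple R n) : 'rV[R]_n :=
  \row_i tnth u i.

Section sphere_measure.
Context {R : realType} (n : nat).

Definition unit_ball : set (Rtuple R n) :=
  [set u | enorm (row_of_tuple u) <= 1].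

Definition unit_sphere : set (Rtuple R n) :=
  [set u | enorm (row_of_tuple u) = 1].

Definition radial_proj (u : Rtuple R n) : Rtuple R n :=
  [tuple tnth u i / enorm (row_of_tuple u) | i < n].

Lemma measurable_enorm :
  measurable_fun setT (fun u : Rtuple R n => enorm (row_of_tuple u)).
Proof.
apply: measurableT_comp; first exact: (continuous_measurable_fun (@sqrt_continuous R)).
rewrite /dot.
apply: measurable_sum => i.
rewrite (_ : (fun _ => _) = (fun u : Rtuple R n => tnth u i * tnth u i)).
  by apply: measurable_funM; exact: measurable_tnth.
by apply/funext => u; rewrite !mxE.
Qed.

Lemma measurable_unit_ball : measurable unit_ball.
Proof.
rewrite -[unit_ball]setTI.
exact: (measurable_enorm measurableT (measurable_itv `]-oo, 1])).
Qed.

Lemma measurable_radial_proj : measurable_fun setT radial_proj.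
Proof.
apply/measurable_fun_tnthP => i.
rewrite (_ : _ \o _ =
    (fun u : Rtuple R n => tnth u i * (enorm (row_of_tuple u))^-1)).
  apply: measurable_funM; first exact: measurable_tnth.
  rewrite (_ : (fun _ => _) =
      (@powR R ^~ (-1)) \o (fun u : Rtuple R n => enorm (row_of_tuple u))).
    by apply: measurableT_comp measurable_enorm; exact: measurable_powR.
  by apply/funext => u /=; rewrite powR_inv1// sqrtr_ge0.
by apply/funext => u /=; rewrite tnth_mktuple.
Qed.

HB.instance Definition _ := isMeasurableFun.Build _ _ _ _ radial_proj
  measurable_radial_proj.

(* Normalized surface measure of the unit sphere of R^n:
     sigma(A) = |{r a : a in A, 0 < r <= 1}| / |{u : |u| <= 1}|,
   with |.| the Lebesgue measure.  The dirac argument of mnormalize is a junk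
   value, used only if the ball had measure 0 or +oo. *)
Definition sphere_measure : probability (Rtuple R n) R :=
  distribution
    (mnormalize (mrestr (@lebesgue_tuple R n) measurable_unit_ball)
       \d_([tuple 0 | _ < n] : Rtuple R n))
    radial_proj.

End sphere_measure.

Arguments sphere_measure R n : clear implicits.
Arguments unit_sphere R n : clear implicits.

Definition peval (R : realType) n (p : mpoly.mpoly n R) (x : 'rV[R]_n) : R :=
  mpoly.meval (fun i => x 0 i) p.

Section designs.
Context {R : realType}.
Local Open Scope fset_scope.

(* mpoly.msize p is 1 + the total degree of p (and 0 for p = 0). *)
Definition weighted_design n (t : nat) (X : {fset 'rV[R]_n})
    (w : 'rV[R]_n -> R) : Prop :=
  [/\ forall x, x \in X -> enorm x = 1,
      forall x, x \in X -> 0 < w x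
    & forall p : mpoly.mpoly n R, (mpoly.msize p <= t.+1)%N ->
        \int[sphere_measure R n]_(u in unit_sphere R n)
            peval p (row_of_tuple u) =
        (\sum_(x <- X) w x)^-1 * \sum_(x <- X) w x * peval p x].

(* Weighted design on S(V), for dim V = k, through a linear isometry phi from
   R^k onto V.  By O(k)-invariance the choice of phi is immaterial. *)
Definition weighted_design_on n k (s : nat) (V : {vspace 'rV[R]_n})
    (Y : {fset 'rV[R]_n}) (w : 'rV[R]_n -> R) : Prop :=
  exists phi : 'Hom('rV[R]_k, 'rV[R]_n),
    [/\ limg phi = V, forall x, enorm (phi x) = enorm x
      & exists2 X : {fset 'rV[R]_k}, Y = phi @` X &
          weighted_design s X (fun x => w (phi x))].

(* P_V x, the unique y in V such that x - y is orthogonal to V. *)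
Definition orth_proj n (V : {vspace 'rV[R]_n}) (x : 'rV[R]_n) : 'rV[R]_n :=
  xget 0 [set y | y \in V /\ forall v, v \in V -> dot (x - y) v = 0]%classic.

Definition tight_fusion_frame n (t : nat) (D : {fset {vspace 'rV[R]_n}})
    (omega : {vspace 'rV[R]_n} -> R) : Prop :=
  (forall V, V \in D -> 0 < omega V) /\
  exists2 A : R, 0 < A &
    forall x : 'rV[R]_n,
      \sum_(V <- D) omega V * enorm (orth_proj V x) ^+ (2 * t) =
      A * enorm x ^+ (2 * t).

End designs.

(* Main.v *)
From HB Require Import structures.
Require Import Defs.
From mathcomp Require Import all_boot all_order all_algebra finmap.
From mathcomp Require Import -(notations) mpoly.
From mathcomp Require Import all_classical all_reals all_analysis.
From mathcomp Require Import measurable_realfun ring lra.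
Import Order.TTheory GRing.Theory Num.Theory.
Import numFieldNormedType.Exports.
Set Implicit Arguments.
Unset Strict Implicit.
Local Open Scope classical_set_scope.
Local Open Scope ring_scope.

(** Write [L f] for the average over [V], with weights [omega V], of the mean
    over S(V) of a polynomial [f], and [I f] for its mean over the full
    sphere.  Each [Y V] integrates exactly in degree at most [s] and all have
    the same total mass, so in those degrees the quadrature sum of [(Z, w)]
    divided by its mass is [L f].  It remains to see that [L] and [I] agree in
    degree at most [2t + 1].

    Both are linear, depend only on the values of [f] on the sphere, and send
    1 to 1.  Rotation invariance makes the mean of [<a, x>^m] over a sphere a
    constant times [|a|^m], and that constant is 0 for odd [m]
    ([sphere_integral_pow], [sphere_integral_odd]).  Since
    [<a, phi y> = <phi^* a, y>] and [|phi^* a| = |P_V a|] for an isometry [phi]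
    onto [V], the value [L (<a, x>^m)] is a constant times the frame sum of
    [|P_V a|^m]; the frame identity turns it into a constant times [|a|^m] for
    [m = 2t], and it vanishes for [m = 2t + 1].

    A functional killing every [<a, x>^m] kills every form of degree [m] by
    polarization, and also the forms of degree [m - 2], [m - 4], ..., since
    these can be multiplied by [|x|^2 = 1] ([functional_vanish]).  Thus two
    functionals with the above properties coincide in degree at most
    [2t + 1]; the constants attached to [m = 2t] must match because both
    functionals are normalized ([functional_unique]).  Raising degrees in this
    way uses the frame identity only at the exponent [2t], so one never has to
    pass from a tight [t]-fusion frame to tight frames of lower order.

    The surface measure is the image under radial projection of Lebesgue
    measure on the ball, and Lebesgue measure is an iterated product.  Its
    rotation invariance comes from writing a rotation as three shears: a shear
    is a translation in each fibre of the product, hence preserves the measure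
    by Fubini ([preserves_fiberl], [preserves_fiberr], [isometry_to_unit]).

    Polynomials are handled throughout as combinations of products of linear
    forms, because this family is stable under composition with a linear map
    and reduces polarization to a one-variable polynomial identity. *)

(** * Maps preserving a measure *)

Definition preserves (R : realType) d (T : measurableType d)
    (mu : set T -> \bar R) (f : T -> T) : Prop :=
  measurable_fun setT f /\
  forall A, measurable A -> mu (f @^-1` A) = mu A.

Section preserves.
Context {R : realType}.

Lemma preserves_comp d (T : measurableType d) (mu : set T -> \bar R) f g :
  preserves mu f -> preserves mu g -> preserves mu (f \o g).
Proof.
move=> [mf pf] [mg pg]; split; first exact: measurableT_comp.
move=> A mA; rewrite comp_preimage pg ?pf//.
by rewrite -[X in measurable X]setTI; exact: mf.
Qed.

Section product.
Context d1 d2 (T1 : measurableType d1) (T2 : measurableType d2).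
Variables (m1 : {sigma_finite_measure set T1 -> \bar R})
          (m2 : {sigma_finite_measure set T2 -> \bar R}).

Lemma product_measure21 A : measurable A ->
  (m1 \x m2)%E A = (m1 \x^ m2)%E A.
Proof.
by apply: product_measure_unique => A1 A2 mA1 mA2; exact: product_measure2E.
Qed.

(** Fubini: a map that moves points only along the fibres of a product, and
    preserves the measure of each fibre, preserves the product measure. *)
Lemma preserves_fiberr (h : T1 -> T2 -> T2) :
  measurable_fun setT (fun p : T1 * T2 => h p.1 p.2) ->
  (forall x, preserves m2 (h x)) ->
  preserves (m1 \x m2)%E (fun p => (p.1, h p.1 p.2)).
Proof.
move=> mh ph; split.
  exact: measurable_fun_pair measurable_fst mh.
move=> A mA; apply: eq_integral => x _ /=.
rewrite -((ph x).2 (xsection A x)); last exact: measurable_xsection.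
by congr (m2 _); apply/seteqP; split => y; rewrite /xsection /= !inE.
Qed.

Lemma preserves_fiberl (g : T2 -> T1 -> T1) :
  measurable_fun setT (fun p : T1 * T2 => g p.2 p.1) ->
  (forall y, preserves m1 (g y)) ->
  preserves (m1 \x m2)%E (fun p => (g p.2 p.1, p.2)).
Proof.
move=> mg pg; have mG : measurable_fun setT (fun p : T1 * T2 => (g p.2 p.1, p.2)).
  exact: measurable_fun_pair mg measurable_snd.
split=> // A mA; rewrite !product_measure21//; last first.
  by rewrite -[X in measurable X]setTI; exact: mG.
apply: eq_integral => y _ /=.
rewrite -((pg y).2 (ysection A y)); last exact: measurable_ysection.
by congr (m1 _); apply/seteqP; split => x; rewrite /ysection /= !inE.
Qed.
End product.

(** Intervals determine Lebesgue measure, so it is enough to test them. *)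
Lemma preserves_lebesgue_measure (f : R -> R) : measurable_fun setT f ->
  (forall a b, lebesgue_measure (f @^-1` `]a, b]) = lebesgue_measure `]a, b]%classic) ->
  preserves (@lebesgue_measure R) f.
Proof.
move=> mf fab; split=> // A mA; apply/esym.
pose g : measurableTypeR R -> measurableTypeR R := f.
have mg : measurable_fun setT g by [].
pose gM : {mfun measurableTypeR R >-> measurableTypeR R} :=
  HB.pack g (isMeasurableFun.Build _ _ _ _ g mg).
apply: (@lebesgue_measure_unique _ (pushforward (@lebesgue_measure R) gM)) => //.
by move=> _ [[a b] _ <-]; rewrite /pushforward /= -fab.
Qed.

Lemma preserves_lebesgue_translation (c : R) :
  preserves (@lebesgue_measure R) (fun x => x + c).
Proof.
apply: preserves_lebesgue_measure; first exact: measurable_funD.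
move=> a b; rewrite (_ : _ @^-1` _ = `]a - c, b - c]%classic).
  rewrite !lebesgue_measure_itv/= !lte_fin ltrD2r.
  by case: ifP => // _; rewrite -!EFinB; congr EFin; ring.
by apply/seteqP; split => x; rewrite /= !in_itv/= => /andP[? ?]; lra.
Qed.

Lemma preserves_lebesgue_opp : preserves (@lebesgue_measure R) -%R.
Proof.
apply: preserves_lebesgue_measure; first exact: oppr_measurable.
move=> a b; rewrite (_ : _ @^-1` _ = `[- b, - a[%classic).
  rewrite !lebesgue_measure_itv/= !lte_fin ltrN2.
  by case: ifP => // _; rewrite -!EFinB; congr EFin; ring.
by apply/seteqP; split => x; rewrite /= !in_itv/= => /andP[? ?]; lra.
Qed.
End preserves.

(** * Lebesgue measure on tuples: translations and shears *)

Section tuple_maps.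
Context {R : realType}.

Definition tuple_uncons n (u : Rtuple R n.+1) : R * Rtuple R n :=
  (thead u, behead_tuple u).

Lemma tuple_consK n : cancel (@tuple_cons R n) (@tuple_uncons n).
Proof. by case=> x u; congr pair; exact/val_inj. Qed.

Lemma tuple_unconsK n : cancel (@tuple_uncons n) (@tuple_cons R n).
Proof. by move=> u; apply/val_inj; rewrite /= [in RHS](tuple_eta u). Qed.

Lemma measurable_tuple_uncons n : measurable_fun setT (@tuple_uncons n).
Proof.
apply: measurable_fun_pair; first exact: measurable_tnth.
exact: measurable_behead.
Qed.

Lemma preserves_tuple_cons n (T : R * Rtuple R n -> R * Rtuple R n) :
  preserves (@lebesgue_measure R \x lebesgue_tuple n)%E T ->
  preserves (@lebesgue_tuple R n.+1)
    (@tuple_cons R n \o T \o @tuple_uncons n).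
Proof.
move=> [mT pT]; split.
  apply: measurableT_comp (@measurable_tuple_uncons n).
  exact: measurableT_comp (@measurable_tuple_cons R n) mT.
move=> A mA /=; rewrite /lebesgue_cons /pushforward.
rewrite -[RHS]pT; last first.
  by rewrite -[X in measurable X]setTI; exact: measurable_tuple_cons.
by congr (_ _); apply/seteqP; split => p; rewrite /= tuple_consK.
Qed.

Lemma preserves_shear_head n (g : Rtuple R n -> R) :
  measurable_fun setT g ->
  preserves (@lebesgue_measure R \x lebesgue_tuple n)%E
    (fun p : R * Rtuple R n => (p.1 + g p.2, p.2)).
Proof.
move=> mg.
apply: (@preserves_fiberl R _ _ (measurableTypeR R) _ (@lebesgue_measure R)
  (@lebesgue_tuple R n) (fun y x => x + g y)).
  by apply: measurable_funD => //; exact: measurableT_comp.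
by move=> y; exact: preserves_lebesgue_translation.
Qed.

Lemma preserves_flip_head n :
  preserves (@lebesgue_measure R \x lebesgue_tuple n)%E
    (fun p : R * Rtuple R n => (- p.1, p.2)).
Proof.
apply: (@preserves_fiberl R _ _ (measurableTypeR R) _ (@lebesgue_measure R)
  (@lebesgue_tuple R n) (fun _ => -%R)).
  exact: measurableT_comp.
by move=> _; exact: preserves_lebesgue_opp.
Qed.

(** Translation by [b], which is a row vector so that the shear vectors below
    can be scaled. *)
Definition ttrans n (b : 'rV[R]_n) (u : Rtuple R n) : Rtuple R n :=
  [tuple tnth u i + b 0 i | i < n].

Lemma preserves_shear_tail n (b : R -> 'rV[R]_n) :
  (forall i, measurable_fun setT (fun x => b x 0 i)) ->
  (forall x, preserves (@lebesgue_tuple R n) (ttrans (b x))) ->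
  preserves (@lebesgue_measure R \x lebesgue_tuple n)%E
    (fun p : R * Rtuple R n => (p.1, ttrans (b p.1) p.2)).
Proof.
move=> mb pb.
apply: (@preserves_fiberr R _ _ (measurableTypeR R) _ (@lebesgue_measure R)
  (@lebesgue_tuple R n) (fun x => ttrans (b x))) => //.
apply/measurable_fun_tnthP => i.
rewrite (_ : _ \o _ = fun p : R * Rtuple R n => tnth p.2 i + b p.1 0 i).
  apply: measurable_funD.
    apply: (@measurableT_comp _ _ _ _ _ _ (fun u => tnth u i)) => //.
    exact: measurable_tnth.
  by apply: (@measurableT_comp _ _ _ _ _ _ (fun x => b x 0 i)).
by apply/funext => p /=; rewrite tnth_mktuple.
Qed.

Lemma preserves_ttrans n (b : 'rV[R]_n) : preserves (@lebesgue_tuple R n) (ttrans b).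
Proof.
elim: n => [|n IHn] in b *.
  rewrite (_ : ttrans b = id); first by split.
  by apply/funext => u; rewrite [LHS]tuple0 [RHS]tuple0.
pose b' : 'rV[R]_n := \row_j b 0 (lift ord0 j).
pose T1 (p : R * Rtuple R n) := (p.1 + b 0 ord0, p.2).
pose T2 (p : R * Rtuple R n) := (p.1, ttrans b' p.2).
rewrite (_ : ttrans b = @tuple_cons R n \o (T1 \o T2) \o @tuple_uncons n); last first.
  apply/funext => u; apply: eq_from_tnth => i; rewrite tnth_mktuple /=.
  case: (unliftP ord0 i) => [j|] ->; last by rewrite tnth0.
  rewrite tnthS tnth_mktuple mxE; congr (_ + _).
  by rewrite [in LHS](tuple_eta u) tnthS.
apply: preserves_tuple_cons; apply: preserves_comp.
  exact: preserves_shear_head (fun _ => b 0 ord0) _.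
exact: preserves_shear_tail (fun _ => b') _ _.
Qed.
End tuple_maps.

(** * The Euclidean inner product *)

Section dot.
Context {R : realType}.

Lemma dotC n (x y : 'rV[R]_n) : dot x y = dot y x.
Proof. by apply: eq_bigr => i _; rewrite mulrC. Qed.

Lemma dotDl n (x y z : 'rV[R]_n) : dot (x + y) z = dot x z + dot y z.
Proof. by rewrite /dot -big_split; apply: eq_bigr => i _; rewrite mxE mulrDl. Qed.

Lemma dotZl n c (x z : 'rV[R]_n) : dot (c *: x) z = c * dot x z.
Proof. by rewrite /dot mulr_sumr; apply: eq_bigr => i _; rewrite mxE mulrA. Qed.

Lemma dotBl n (x y z : 'rV[R]_n) : dot (x - y) z = dot x z - dot y z.
Proof. by rewrite -scaleN1r dotDl dotZl mulN1r. Qed.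

Lemma dotDr n (x y z : 'rV[R]_n) : dot z (x + y) = dot z x + dot z y.
Proof. by rewrite dotC dotDl !(dotC z). Qed.

Lemma dotZr n c (x z : 'rV[R]_n) : dot z (c *: x) = c * dot z x.
Proof. by rewrite dotC dotZl (dotC z). Qed.

Lemma dot_ge0 n (x : 'rV[R]_n) : 0 <= dot x x.
Proof. by apply: sumr_ge0 => i _; rewrite -expr2 sqr_ge0. Qed.

Lemma dot_eq0 n (x : 'rV[R]_n) : dot x x = 0 -> x = 0.
Proof.
move=> /eqP; rewrite psumr_eq0; last by move=> i _; rewrite -expr2 sqr_ge0.
move=> /allP x0; apply/rowP => i; rewrite mxE; apply/eqP.
by have := x0 i (mem_index_enum _); rewrite -expr2 sqrf_eq0.
Qed.

Lemma sqr_enorm n (x : 'rV[R]_n) : enorm x ^+ 2 = dot x x.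
Proof. by rewrite sqr_sqrtr// dot_ge0. Qed.

Lemma enorm_ge0 n (x : 'rV[R]_n) : 0 <= enorm x.
Proof. exact: sqrtr_ge0. Qed.

Lemma enorm_eq0 n (x : 'rV[R]_n) : enorm x = 0 -> x = 0.
Proof. by move=> x0; apply: dot_eq0; rewrite -sqr_enorm x0 expr0n. Qed.

Lemma enorm_eq1 n (x : 'rV[R]_n) : enorm x = 1 <-> dot x x = 1.
Proof.
split=> [x1|x1]; first by rewrite -sqr_enorm x1 expr1n.
by rewrite /enorm x1 sqrtr1.
Qed.

Lemma enormZ n c (x : 'rV[R]_n) : enorm (c *: x) = `|c| * enorm x.
Proof. by rewrite /enorm dotZl dotZr mulrA -expr2 sqrtrM ?sqr_ge0// sqrtr_sqr. Qed.

Lemma dot_delta n i (x : 'rV[R]_n) : dot (delta_mx 0 i) x = x 0 i.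
Proof.
rewrite /dot (bigD1 i)//= big1 ?addr0 ?mxE ?eqxx ?mul1r//.
by move=> j ji; rewrite mxE (negPf ji) andbF mul0r.
Qed.

Lemma norm_le_enorm n (x : 'rV[R]_n) i : `|x 0 i| <= enorm x.
Proof.
rewrite -sqrtr_sqr ler_wsqrtr// /dot (bigD1 i)//= expr2 lerDl.
by apply: sumr_ge0 => j _; rewrite -expr2 sqr_ge0.
Qed.

(** Tuples are split as head and tail, like the product that defines Lebesgue
    measure; [row_tail] follows that splitting on row vectors. *)
Definition row_tail n (a : 'rV[R]_n.+1) : 'rV[R]_n := \row_j a 0 (lift ord0 j).

Lemma dot_recl n (a b : 'rV[R]_n.+1) :
  dot a b = a 0 ord0 * b 0 ord0 + dot (row_tail a) (row_tail b).
Proof. by rewrite /dot big_ord_recl; congr (_ + _); apply: eq_bigr => i _; rewrite !mxE. Qed.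

Lemma row_tuple_cons0 n (p : R * Rtuple R n) :
  row_of_tuple (tuple_cons p) 0 ord0 = p.1.
Proof. by rewrite mxE tnth0. Qed.

Lemma row_tail_cons n (p : R * Rtuple R n) :
  row_tail (row_of_tuple (tuple_cons p)) = row_of_tuple p.2.
Proof. by apply/rowP => j; rewrite !mxE tnthS. Qed.

Lemma row_ttrans n (b : 'rV[R]_n) u :
  row_of_tuple (ttrans b u) = row_of_tuple u + b.
Proof. by apply/rowP => j; rewrite !mxE tnth_mktuple. Qed.

Lemma measurable_dot_tuple n (a : 'rV[R]_n) :
  measurable_fun setT (fun u : Rtuple R n => dot a (row_of_tuple u)).
Proof.
apply: measurable_sum => i; apply: measurable_funM => //.
under eq_fun do rewrite mxE.
exact: measurable_tnth.
Qed.
End dot.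

(** * Rotations preserve Lebesgue measure *)

Section rotation.
Context {R : realType}.

Definition tscale n (c : R) (u : Rtuple R n) : Rtuple R n :=
  [tuple tnth u i * c | i < n].

Lemma row_tscale n c (u : Rtuple R n) :
  row_of_tuple (tscale c u) = c *: row_of_tuple u.
Proof. by apply/rowP => j; rewrite !mxE tnth_mktuple mulrC. Qed.

(** Radial projection is a scaling: commuting with scalings is what carries
    the invariance of Lebesgue measure over to the surface measure. *)
Record lebesgue_isometry n (U : Rtuple R n -> Rtuple R n) : Prop := {
  isometry_preserves : preserves (@lebesgue_tuple R n) U ;
  isometry_enorm : forall u,
    enorm (row_of_tuple (U u)) = enorm (row_of_tuple u) ;
  isometry_scale : forall c u, U (tscale c u) = tscale c (U u) }.

Definition pscale n (c : R) (p : R * Rtuple R n) : R * Rtuple R n :=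
  (p.1 * c, tscale c p.2).

Lemma tscale_cons n c (p : R * Rtuple R n) :
  tscale c (tuple_cons p) = tuple_cons (pscale c p).
Proof.
apply: eq_from_tnth => i; rewrite tnth_mktuple.
by case: (unliftP ord0 i) => [j|] ->; rewrite ?tnthS ?tnth0 ?tnth_mktuple.
Qed.

Lemma tuple_uncons_scale n c (u : Rtuple R n.+1) :
  tuple_uncons (tscale c u) = pscale c (tuple_uncons u).
Proof. by rewrite -[in LHS](tuple_unconsK u) tscale_cons tuple_consK. Qed.

Lemma lebesgue_isometry_cons n (T : R * Rtuple R n -> R * Rtuple R n) :
  preserves (@lebesgue_measure R \x lebesgue_tuple n)%E T ->
  (forall p, (T p).1 * (T p).1 + dot (row_of_tuple (T p).2) (row_of_tuple (T p).2) =
    p.1 * p.1 + dot (row_of_tuple p.2) (row_of_tuple p.2)) ->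
  (forall c p, T (pscale c p) = pscale c (T p)) ->
  @lebesgue_isometry n.+1 (@tuple_cons R n \o T \o @tuple_uncons R n).
Proof.
move=> pT nT sT; split.
- exact: preserves_tuple_cons.
- move=> u; rewrite -[in RHS](tuple_unconsK u).
  by rewrite /enorm !dot_recl !row_tuple_cons0 !row_tail_cons nT.
- by move=> c u; rewrite tscale_cons -sT -tuple_uncons_scale.
Qed.

(** A unit vector is the first row of some measure-preserving isometry.  If
    [a = (c, s v)] with [|v| = 1] and [s <> 0], rotate in the plane spanned by
    the first axis and [v].  With [tau = (1 - c) / s], the tangent of half the
    angle, this rotation is the shear [x += tau <v, y>], then
    [y -= s x v], then the first shear again. *)
Lemma isometry_to_unit n (a : 'rV[R]_n.+1) : enorm a = 1 ->
  exists2 U, @lebesgue_isometry n.+1 U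
    & forall u, row_of_tuple (U u) 0 ord0 = dot a (row_of_tuple u).
Proof.
move=> /enorm_eq1 a1.
suff [T isoT Ta] : exists2 T,
    @lebesgue_isometry n.+1 (@tuple_cons R n \o T \o @tuple_uncons R n)
    & forall p, (T p).1 = a 0 ord0 * p.1 + dot (row_tail a) (row_of_tuple p.2).
  exists (@tuple_cons R n \o T \o @tuple_uncons R n) => // u.
  rewrite row_tuple_cons0 Ta dot_recl -[in RHS](tuple_unconsK u).
  by rewrite row_tuple_cons0 row_tail_cons.
move: a1; rewrite dot_recl.
set c := a 0 ord0; set a' := row_tail a => a1.
have [a'0|a'0] := eqVneq (enorm a') 0.
  have {}a'0 := enorm_eq0 a'0.
  have d0 w : dot a' w = 0 by rewrite a'0 -(scale0r 0) dotZl mul0r.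
  move: a1; rewrite d0 addr0 => /eqP; rewrite -expr2 sqrf_eq1 => /orP[] /eqP ->.
    exists id; last by move=> p; rewrite d0 addr0 mul1r.
    by apply: lebesgue_isometry_cons.
  exists (fun p => (- p.1, p.2)); last by move=> p; rewrite d0 addr0 mulN1r.
  apply: lebesgue_isometry_cons => [|p|k p] /=.
  - exact: preserves_flip_head.
  - by rewrite mulrNN.
  - by rewrite /pscale mulNr.
pose s := enorm a'; pose v := s^-1 *: a'; pose tau := (1 - c) / s.
have sv : a' = s *: v by rewrite scalerA mulfV// scale1r.
have ss : s * s = 1 - c * c by rewrite -expr2 sqr_enorm -a1; ring.
have vv : dot v v = 1.
  by rewrite dotZl dotZr -sqr_enorm -/s; field.
have taus : tau * s = 1 - c by rewrite mulfVK.
(* Only the relations between c, s, tau and v matter, not their definitions. *)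
have s0 : s != 0 by [].
clearbody tau v s.
pose S1 (p : R * Rtuple R n) := (p.1 + tau * dot v (row_of_tuple p.2), p.2).
pose S2 (p : R * Rtuple R n) := (p.1, ttrans ((- s * p.1) *: v) p.2).
have pS1 : preserves (@lebesgue_measure R \x lebesgue_tuple n)%E S1.
  apply: (@preserves_shear_head _ _ (fun y => tau * dot v (row_of_tuple y))).
  by apply: measurable_funM => //; exact: measurable_dot_tuple.
have pS2 : preserves (@lebesgue_measure R \x lebesgue_tuple n)%E S2.
  apply: (@preserves_shear_tail _ _ (fun x => (- s * x) *: v)).
    move=> i; under eq_fun do rewrite mxE.
    by do 2 (apply: measurable_funM => //).
  by move=> x; exact: preserves_ttrans.
have S1s k p : S1 (pscale k p) = pscale k (S1 p).
  by rewrite /S1 /pscale /= row_tscale dotZr; congr (_, _); ring.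
have S2s k p : S2 (pscale k p) = pscale k (S2 p).
  rewrite /S2 /pscale /=; congr (_, _); apply: eq_from_tnth => i.
  by rewrite !tnth_mktuple !mxE; ring.
have T1 p : (S1 (S2 (S1 p))).1 = c * p.1 + s * dot v (row_of_tuple p.2).
  rewrite /= row_ttrans dotDr dotZr vv; set x := p.1; set q := dot _ _.
  have tauc : tau * (1 + c) = s.
    apply: (mulIf s0); rewrite ss; transitivity (tau * s * (1 + c)); first ring.
    by rewrite taus; ring.
  transitivity ((1 - tau * s) * x + (tau + tau * (1 - tau * s)) * q); first ring.
  by rewrite taus -[in RHS]tauc; ring.
exists (S1 \o (S2 \o S1)); last first.
  by move=> p; rewrite [LHS](T1 p) sv dotZl.
apply: lebesgue_isometry_cons => [|p|k p].
- by apply: preserves_comp => //; exact: preserves_comp.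
- rewrite [((S1 \o _) p).1](T1 p) /= row_ttrans !(dotDl, dotDr, dotZl, dotZr) vv (dotC _ v).
  set x := p.1; set q := dot v _; set y := dot _ _.
  have sx : - s * (x + tau * q) = - s * x - (1 - c) * q by rewrite -taus; ring.
  rewrite sx; transitivity (x * x * (c * c + s * s) + y + q * q * (s * s + c * c - 1)); first ring.
  by rewrite ss; ring.
- by rewrite /= S1s S2s S1s.
Qed.
End rotation.

(** * The surface measure *)

Section sphere.
Context {R : realType}.

Definition box n (r : R) : set (Rtuple R n) :=
  [set u | forall i, `|tnth u i| <= r].

Lemma box_cons n r :
  @tuple_cons R n @^-1` box r = `[- r, r]%classic `*` box r.
Proof.
apply/seteqP; split=> [[x u] /= b|[x u] /= [xr b] i].
  split=> [|i]; first by rewrite /= in_itv/= -ler_norml; have := b ord0; rewrite tnth0.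
  by have := b (lift ord0 i); rewrite tnthS.
case: (unliftP ord0 i) => [j|] ->; first by rewrite tnthS.
by rewrite tnth0 ler_norml; move: xr; rewrite /= in_itv.
Qed.

Lemma measurable_box n r : measurable (@box n r).
Proof.
rewrite (_ : box r = \bigcap_(i in [set: 'I_n])
    ((fun u : Rtuple R n => `|tnth u i|) @^-1` `]-oo, r]%classic)).
  apply: fin_bigcap_measurable => // i _.
  rewrite -[X in measurable X]setTI.
  have mi : measurable_fun setT (fun u : Rtuple R n => `|tnth u i|).
    by apply: measurableT_comp => //; exact: measurable_tnth.
  by apply: mi => //; exact: measurable_itv.
apply/seteqP; split=> u b i /=; first by rewrite in_itv/=.
by have := b i Logic.I; rewrite /= in_itv.
Qed.

Lemma lebesgue_box n (r : R) : 0 <= r ->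
  lebesgue_tuple n (box r) = ((r *+ 2) ^+ n)%:E.
Proof.
move=> r0; elim: n => [|n IHn] /=.
  by rewrite diracE mem_set// => -[].
rewrite /lebesgue_cons /pushforward box_cons.
transitivity (mule (lebesgue_measure (`[- r, r]%classic : set R))
    (lebesgue_tuple n (box r))).
  by apply: product_measure1E => //; exact: measurable_box.
rewrite IHn lebesgue_measure_itv/= lte_fin.
case: ifPn => [_|].
  by rewrite -EFinB -EFinM exprS; congr (_ * _)%:E; ring.
rewrite -leNgt => rr; have -> : r = 0 by lra.
by rewrite mul0e mul0rn expr0n.
Qed.

(** Cubes have explicit measure; squeezing the ball between two of them shows
    that the normalization in the surface measure is not degenerate. *)
Lemma sub_box_ball n : box n.+1%:R^-1 `<=` @unit_ball R n.+1.
Proof.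
move=> u bu; rewrite /unit_ball /= -(@expr_le1 _ 2)// ?enorm_ge0// sqr_enorm.
rewrite (@le_trans _ _ (\sum_(i < n.+1) n.+1%:R^-1))//; last first.
  by rewrite sumr_const card_ord -[leLHS]mulr_natr mulVf.
apply: ler_sum => i _; rewrite !mxE -expr2 -real_normK ?num_real// expr2.
rewrite (le_trans (ler_pM _ _ (bu i) (bu i)))//.
by rewrite ler_piMr// invf_le1// ler1n.
Qed.

Lemma sub_ball_box n : @unit_ball R n `<=` box 1.
Proof.
move=> u bu i; apply: le_trans bu.
by have := norm_le_enorm (row_of_tuple u) i; rewrite mxE.
Qed.

Lemma lebesgue_ball_gt0 n : (0 < lebesgue_tuple n.+1 (@unit_ball R n.+1))%E.
Proof.
apply: (@lt_le_trans _ _ (lebesgue_tuple n.+1 (box n.+1%:R^-1))).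
  by rewrite lebesgue_box// lte_fin exprn_gt0// pmulrn_rgt0// invr_gt0.
apply: le_measure; rewrite ?inE; [exact: measurable_box|exact: measurable_unit_ball|].
exact: sub_box_ball.
Qed.

Lemma lebesgue_ball_lty n : (lebesgue_tuple n (@unit_ball R n) < +oo)%E.
Proof.
apply: (@le_lt_trans _ _ (lebesgue_tuple n (box 1))).
  apply: le_measure; rewrite ?inE; [exact: measurable_unit_ball|exact: measurable_box|].
  exact: sub_ball_box.
by rewrite lebesgue_box// ltry.
Qed.

Lemma mnormalizeE d (T : measurableType d) (mu : {measure set T -> \bar R})
    (P : probability T R) (A : set T) (c : \bar R) :
  (0 < c)%E -> (c < +oo)%E -> mu setT = c ->
  mnormalize mu P A = (mu A * (fine c)^-1%:E)%E.
Proof. by move=> c0 coo muT; rewrite /mnormalize muT gt_eqF ?lt_eqF. Qed.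

Lemma sphere_measureE n (A : set (Rtuple R n.+1)) :
  sphere_measure R n.+1 A =
  (lebesgue_tuple n.+1 (@radial_proj R n.+1 @^-1` A `&` @unit_ball R n.+1) *
   (fine (lebesgue_tuple n.+1 (@unit_ball R n.+1)))^-1%:E)%E.
Proof.
have e : mrestr (lebesgue_tuple n.+1) (@measurable_unit_ball R n.+1) setT =
    lebesgue_tuple n.+1 (@unit_ball R n.+1) by rewrite /mrestr setTI.
have := @mnormalizeE _ _ (mrestr (lebesgue_tuple n.+1) (@measurable_unit_ball R n.+1))
  \d_([tuple 0 | _ < n.+1] : Rtuple R n.+1) (@radial_proj R n.+1 @^-1` A) _
  (lebesgue_ball_gt0 n) (lebesgue_ball_lty n.+1) e.
exact.
Qed.

Lemma measurable_unit_sphere n : measurable (unit_sphere R n).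
Proof.
rewrite -[unit_sphere R n]setTI.
exact: (@measurable_enorm R n measurableT _ (measurable_set1 1)).
Qed.

Lemma row_radial_proj n (u : Rtuple R n) :
  row_of_tuple (radial_proj u) = (enorm (row_of_tuple u))^-1 *: row_of_tuple u.
Proof. exact: row_tscale. Qed.

(** The radial projection of a point lies on the sphere unless the point is
    the origin, which is a cube of side 0 and hence negligible. *)
Lemma sphere_measure_sphere n :
  sphere_measure R n.+1 (unit_sphere R n.+1) = 1%E.
Proof.
rewrite sphere_measureE; set B := @unit_ball R n.+1; set L := lebesgue_tuple n.+1.
have LBoo : (L B < +oo)%E by exact: lebesgue_ball_lty.
have LB0 : (0 < L B)%E by exact: lebesgue_ball_gt0.
have -> : L (@radial_proj R n.+1 @^-1` unit_sphere R n.+1 `&` B) = L B.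
  rewrite (_ : _ `&` B = B `\` box 0); last first.
    rewrite setIC; congr (B `&` _); apply/seteqP; split=> u /=;
      rewrite /unit_sphere /= row_radial_proj enormZ.
      move=> Su u0; have {u0} : row_of_tuple u = 0.
        apply/rowP => i; rewrite !mxE; apply/eqP.
        by rewrite -normr_le0; exact: u0.
      by move=> u0; move/eqP: Su; rewrite u0 -(scale0r 0) enormZ normr0 mul0r mulr0 eq_sym oner_eq0.
    move=> u0; rewrite normfV ger0_norm ?enorm_ge0// mulVf//.
    apply/eqP => /enorm_eq0 /rowP ru; apply: u0 => i.
    by have := ru i; rewrite !mxE => ->; rewrite normr0.
  have mB : measurable B by exact: measurable_unit_ball.
  have m0 : measurable (@box n.+1 0) by exact: measurable_box.
  have L0 : L (B `&` box 0) = 0%E.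
    apply: subset_measure0 (_ : L (box 0) = 0%E); [exact: measurableI|by []|exact: subIsetr|].
    by rewrite [LHS]lebesgue_box// mul0rn expr0n.
  transitivity (L B - L (B `&` box 0))%E; last by rewrite L0 sube0.
  by apply: measureD.
by rewrite -{1}(@fineK _ (L B)) -?EFinM ?mulfV// ?gt_eqF ?fine_gt0 ?LB0// ge0_fin_numE// ltW.
Qed.

Lemma sphere_measure_isometry n (U : Rtuple R n.+1 -> Rtuple R n.+1) A :
  lebesgue_isometry U -> measurable A ->
  sphere_measure R n.+1 (U @^-1` A) = sphere_measure R n.+1 A.
Proof.
move=> [[mU pU] nU sU] mA; rewrite !sphere_measureE; congr (_ * _)%E.
rewrite -[RHS]pU; last first.
  apply: measurableI; last exact: measurable_unit_ball.
  by rewrite -[X in measurable X]setTI; exact: measurable_radial_proj.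
have rU u : radial_proj (U u) = U (radial_proj u).
  by rewrite [RHS]sU -nU.
congr (lebesgue_tuple _ _); apply/seteqP; split => u;
  by rewrite /= rU /unit_ball /= nU.
Qed.
End sphere.

(** * Integrals of products of linear forms over the sphere *)

Section sphere_integral.
Context {R : realType}.

Definition sphere_integral n (f : 'rV[R]_n -> R) : R :=
  \int[sphere_measure R n]_(u in unit_sphere R n) f (row_of_tuple u).

Definition form_prod n (s : seq 'rV[R]_n) (x : 'rV[R]_n) : R :=
  \prod_(a <- s) dot a x.

Definition form_comb n (P : seq (R * seq 'rV[R]_n)) (x : 'rV[R]_n) : R :=
  \sum_(m <- P) m.1 * form_prod m.2 x.

Lemma form_prod_nseq n m (a x : 'rV[R]_n) :
  form_prod (nseq m a) x = dot a x ^+ m.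
Proof. by rewrite /form_prod big_nseq iter_mulr_1. Qed.

Lemma form_prod_perm n (s1 s2 : seq 'rV[R]_n) :
  perm_eq s1 s2 -> form_prod s1 = form_prod s2.
Proof. by move=> s12; apply/funext => x; exact: perm_big. Qed.

Lemma form_prod_cat n (s1 s2 : seq 'rV[R]_n) x :
  form_prod (s1 ++ s2) x = form_prod s1 x * form_prod s2 x.
Proof. exact: big_cat. Qed.

Lemma form_prod_cons n (a : 'rV[R]_n) s x :
  form_prod (a :: s) x = dot a x * form_prod s x.
Proof. exact: big_cons. Qed.

Lemma measurable_form_prod n (s : seq 'rV[R]_n) :
  measurable_fun setT (fun u => form_prod s (row_of_tuple u)).
Proof. by apply: measurable_prod => a _; exact: measurable_dot_tuple. Qed.

Lemma norm_dot_le n (a x : 'rV[R]_n) :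
  enorm x = 1 -> `|dot a x| <= \sum_i `|a 0 i|.
Proof.
move=> x1; apply: le_trans (ler_norm_sum _ _ _) _; apply: ler_sum => i _.
by rewrite normrM ler_piMr// -x1 norm_le_enorm.
Qed.

Lemma norm_form_prod_le n (s : seq 'rV[R]_n) x :
  enorm x = 1 -> `|form_prod s x| <= \prod_(a <- s) \sum_i `|a 0 i|.
Proof.
move=> x1; rewrite /form_prod normr_prod; apply: ler_prod => a _.
by rewrite normr_ge0 norm_dot_le.
Qed.

Lemma integrable_sphere n (g : Rtuple R n -> R) : measurable_fun setT g ->
  (exists C, forall u, unit_sphere R n u -> `|g u| <= C) ->
  (sphere_measure R n).-integrable (unit_sphere R n) (EFin \o g).
Proof.
move=> mg [C gC]; apply: measurable_bounded_integrable.
- exact: measurable_unit_sphere.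
- apply: le_lt_trans (ltry 1); apply: probability_le1.
  exact: measurable_unit_sphere.
- exact: measurable_funTS.
exists C; split; first exact: num_real.
by move=> M CM u u1; apply: le_trans (ltW CM); exact: gC.
Qed.

Lemma integrable_form_prod n (s : seq 'rV[R]_n) :
  (sphere_measure R n).-integrable (unit_sphere R n)
    (EFin \o (fun u => form_prod s (row_of_tuple u))).
Proof.
apply: integrable_sphere; first exact: measurable_form_prod.
by exists (\prod_(a <- s) \sum_i `|a 0 i|) => u; exact: norm_form_prod_le.
Qed.

Lemma integrable_form_comb n P :
  (sphere_measure R n).-integrable (unit_sphere R n)
    (EFin \o (fun u => form_comb P (row_of_tuple u))).
Proof.
have mS := @measurable_unit_sphere R n.
elim: P => [|m P IHP].
  rewrite (_ : _ \o _ = cst 0%E); first exact: integrable0.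
  by apply/funext => u; rewrite /= /form_comb big_nil.
rewrite (_ : _ \o _ = ((EFin \o (fun u => m.1 * form_prod m.2 (row_of_tuple u))%R)
   \+ (EFin \o (fun u => form_comb P (row_of_tuple u))%R))%E).
  apply: integrableD => //.
  under [X in _.-integrable _ X]eq_fun do rewrite /= EFinM.
  by apply: integrableZl => //; exact: integrable_form_prod.
by apply/funext => u; rewrite /= /form_comb big_cons.
Qed.

Lemma sphere_integral_comb n (P : seq (R * seq 'rV[R]_n)) :
  sphere_integral (form_comb P) =
  \sum_(m <- P) m.1 * sphere_integral (form_prod m.2).
Proof.
have mS := @measurable_unit_sphere R n.
elim: P => [|m P IHP].
  rewrite big_nil; transitivity (\int[sphere_measure R n]_(u in unit_sphere R n) (0:R)).
    by apply: eq_Rintegral => u _; rewrite /form_comb big_nil.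
  by rewrite Rintegral_cst// mul0r.
rewrite big_cons -IHP /sphere_integral -RintegralZl//; last exact: integrable_form_prod.
rewrite -RintegralD//; last exact: integrable_form_comb.
  by apply: eq_Rintegral => u _; rewrite /form_comb big_cons.
rewrite (_ : _ \o _ = EFin \o (fun u => form_comb [:: m] (row_of_tuple u))).
  exact: integrable_form_comb.
by apply/funext => u; rewrite /= /form_comb big_seq1.
Qed.

Lemma eq_sphere_integral n (f g : 'rV[R]_n -> R) :
  (forall x, enorm x = 1 -> f x = g x) -> sphere_integral f = sphere_integral g.
Proof. by move=> fg; apply: eq_Rintegral => u; rewrite inE => u1; exact: fg. Qed.

Lemma sphere_integral1 n : @sphere_integral n.+1 (fun=> 1) = 1.
Proof.
rewrite /sphere_integral Rintegral_cst; last exact: measurable_unit_sphere.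
by rewrite mul1r; exact: (congr1 fine (sphere_measure_sphere n)).
Qed.

Lemma sphere_integral_isometry n (U : Rtuple R n.+1 -> Rtuple R n.+1) s :
  lebesgue_isometry U ->
  \int[sphere_measure R n.+1]_(u in unit_sphere R n.+1)
     form_prod s (row_of_tuple (U u)) = sphere_integral (form_prod s).
Proof.
move=> isoU; have [[mU _] nU _] := isoU; congr fine.
have mS := @measurable_unit_sphere R n.+1.
have USS : U @^-1` unit_sphere R n.+1 = unit_sphere R n.+1.
  by apply/seteqP; split => u; rewrite /unit_sphere /= nU.
have mf : measurable_fun setT (EFin \o (fun u => form_prod s (row_of_tuple u))).
  by apply/measurable_EFinP; exact: measurable_form_prod.
rewrite -[in LHS]USS.
have iU : (sphere_measure R n.+1).-integrable (U @^-1` unit_sphere R n.+1)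
    ((EFin \o (fun u => form_prod s (row_of_tuple u))) \o U).
  rewrite USS.
  apply: (@integrable_sphere _ (fun u => form_prod s (row_of_tuple (U u)))).
    exact: measurableT_comp (measurable_form_prod s) mU.
  exists (\prod_(a <- s) \sum_i `|a 0 i|) => u u1.
  by apply: norm_form_prod_le; rewrite nU.
transitivity (\int[pushforward (sphere_measure R n.+1) U]_(u in unit_sphere R n.+1)
    (form_prod s (row_of_tuple u))%:E)%E.
  exact/esym/(integral_pushforward mU mf iU mS).
apply: eq_measure_integral => A mA _.
exact: sphere_measure_isometry.
Qed.

(** Some isometry turns the first coordinate into [<a, x>]. *)
Lemma sphere_integral_unit n (a : 'rV[R]_n.+1) m : enorm a = 1 ->
  sphere_integral (fun x => dot a x ^+ m) = sphere_integral (fun x : 'rV[R]_n.+1 => x 0 ord0 ^+ m).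
Proof.
move=> /isometry_to_unit[U isoU Ua].
pose e : 'rV[R]_n.+1 := delta_mx 0 ord0.
transitivity (sphere_integral (form_prod (nseq m e))); last first.
  by apply: eq_sphere_integral => x _; rewrite form_prod_nseq dot_delta.
rewrite -(sphere_integral_isometry _ isoU); apply: eq_Rintegral => u _.
by rewrite form_prod_nseq dot_delta Ua.
Qed.

Lemma sphere_integral_pow n m : exists c, forall a : 'rV[R]_n.+1,
  sphere_integral (fun x => dot a x ^+ m) = c * enorm a ^+ m.
Proof.
exists (sphere_integral (fun x : 'rV[R]_n.+1 => x 0 ord0 ^+ m)) => a.
have [a1 a11 aE] : exists2 a1 : 'rV_n.+1, enorm a1 = 1 & a = enorm a *: a1.
  have [a0|a0] := eqVneq (enorm a) 0; last first.
    exists ((enorm a)^-1 *: a); last by rewrite scalerA mulfV// scale1r.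
    by rewrite enormZ normfV ger0_norm ?enorm_ge0// mulVf.
  exists (delta_mx 0 ord0); last by rewrite a0 scale0r; exact: enorm_eq0.
  by apply/enorm_eq1; rewrite dot_delta mxE !eqxx.
rewrite -(sphere_integral_unit _ a11).
transitivity (sphere_integral (form_comb [:: (enorm a ^+ m, nseq m a1)])).
  apply: eq_sphere_integral => x _.
  by rewrite /form_comb big_seq1 /= form_prod_nseq {1}aE dotZl exprMn.
rewrite sphere_integral_comb big_seq1 mulrC /=; congr (_ * _).
by apply: eq_sphere_integral => x _; rewrite form_prod_nseq.
Qed.

(** The mean depends only on [enorm a], yet replacing [a] by [- a] changes its
    sign. *)
Lemma sphere_integral_odd n m (a : 'rV[R]_n.+1) : odd m ->
  sphere_integral (fun x => dot a x ^+ m) = 0.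
Proof.
move=> oddm; have [c cE] := sphere_integral_pow n m.
have nE : enorm (- a) = enorm a by rewrite -scaleN1r enormZ normrN1 mul1r.
have : sphere_integral (fun x => dot (- a) x ^+ m) =
    - sphere_integral (fun x => dot a x ^+ m).
  transitivity (sphere_integral (form_comb [:: (-1, nseq m a)])).
    apply: eq_sphere_integral => x _.
    rewrite /form_comb big_seq1 /= form_prod_nseq -scaleN1r dotZl exprMn.
    by rewrite -signr_odd oddm expr1.
  rewrite sphere_integral_comb big_seq1 mulN1r /=; congr (- _).
  by apply: eq_sphere_integral => x _; rewrite form_prod_nseq.
by rewrite !cE nE => ?; lra.
Qed.
End sphere_integral.

(** * Functionals determined by powers of linear forms *)

Section functional.
Context {R : realType}.

(** An abstract stand-in for integration over the sphere.  Linearity is asked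
    only on combinations of products of linear forms, since the integral is
    not additive on arbitrary functions. *)
Record sphere_functional n (L : ('rV[R]_n -> R) -> R) : Prop := {
  functional_comb : forall P,
    L (form_comb P) = \sum_(m <- P) m.1 * L (form_prod m.2) ;
  functional_eq : forall f g : 'rV[R]_n -> R,
    (forall x, enorm x = 1 -> f x = g x) -> L f = L g }.

Lemma sphere_integral_functional n : sphere_functional (@sphere_integral R n).
Proof. by split; [exact: sphere_integral_comb|exact: eq_sphere_integral]. Qed.

Lemma functional_lin n (L1 L2 : ('rV[R]_n -> R) -> R) c1 c2 :
  sphere_functional L1 -> sphere_functional L2 ->
  sphere_functional (fun f => c1 * L1 f + c2 * L2 f).
Proof.
move=> [comb1 eq1] [comb2 eq2]; split=> [P|f g fg]; last by rewrite (eq1 _ _ fg) (eq2 _ _ fg).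
rewrite comb1 comb2 !mulr_sumr -big_split; apply: eq_bigr => m _ /=; ring.
Qed.

Lemma poly_eq0_of_horner (q : {poly R}) : (forall c, q.[c] = 0) -> q = 0.
Proof.
move=> q0; apply/eqP/negPn/negP => qn0.
have := @max_poly_roots _ q [seq i%:R | i <- iota 0 (size q)] qn0.
rewrite size_map size_iota ltnn => root_q; apply: notF; apply: root_q.
  by apply/allP => c _; apply/rootP.
by rewrite map_inj_uniq ?iota_uniq// => i j /eqP; rewrite eqr_nat => /eqP.
Qed.

(** Factors are freed one at a time: if [L] kills [g * <a, x>^(j+1)] for all
    [a], then replacing [a] by [a + c b] gives a polynomial in [c] that is
    identically 0, and its linear coefficient is
    [(j+1) L (g * <b, x> * <a, x>^j)]. *)
Lemma functional_polarization n (L : ('rV[R]_n -> R) -> R) m :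
  sphere_functional L -> (forall a, L (fun x => dot a x ^+ m) = 0) ->
  forall s, size s = m -> L (form_prod s) = 0.
Proof.
move=> [combL eqL] L0.
suff H : forall s a j, (size s + j)%N = m -> L (form_prod (s ++ nseq j a)) = 0.
  by move=> s sm; rewrite -(cats0 s) (H s 0 0%N)// addn0.
elim=> [|b s IHs] a j sj.
  by rewrite -[RHS](L0 a); apply: eqL => x _; rewrite form_prod_nseq -sj.
pose t i := s ++ nseq (j.+1 - i) a ++ nseq i b.
pose q := \poly_(i < j.+2) ('C(j.+1, i)%:R * L (form_prod (t i))).
have q0 : q = 0.
  apply: poly_eq0_of_horner => c; rewrite horner_poly.
  transitivity (L (form_comb [seq ('C(j.+1, i)%:R * c ^+ i, t i) | i : 'I_j.+2])).
    by rewrite combL big_image /=; apply: eq_bigr => i _; ring.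
  rewrite -[RHS](IHs (a + c *: b) j.+1); last by rewrite -sj addnS.
  apply: eqL => x _; rewrite form_prod_cat form_prod_nseq dotDl dotZl exprDn.
  rewrite mulr_sumr /form_comb big_image /=; apply: eq_bigr => i _.
  by rewrite /t !form_prod_cat !form_prod_nseq exprMn -mulr_natr; ring.
have := congr1 (fun p : {poly R} => p`_1) q0.
rewrite coef_poly /= coef0 bin1 => /eqP; rewrite mulf_eq0 pnatr_eq0 /= => /eqP <-.
congr L; apply: form_prod_perm; rewrite /t subn1 /=.
by rewrite catA cats1 perm_sym perm_rcons.
Qed.

(** On the sphere a form may be multiplied by [|x|^2], the sum of the squared
    coordinates. *)
Lemma functional_raise n (L : ('rV[R]_n -> R) -> R) s :
  sphere_functional L ->
  L (form_prod s) =
  \sum_(i < n) L (form_prod [:: delta_mx 0 i, delta_mx 0 i & s]).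
Proof.
move=> [combL eqL].
transitivity (L (form_comb
    [seq (1 : R, [:: delta_mx 0 i, delta_mx 0 i & s]) | i : 'I_n])); last first.
  rewrite combL big_image /=; apply: eq_bigr => i _; exact: mul1r.
apply: eqL => x /enorm_eq1 x1; rewrite /form_comb big_image /=.
transitivity (dot x x * form_prod s x); first by rewrite x1 mul1r.
rewrite mulr_suml; apply: eq_bigr => i _.
by rewrite mul1r !form_prod_cons !dot_delta mulrA.
Qed.

Lemma functional_vanish n (L : ('rV[R]_n -> R) -> R) m :
  sphere_functional L -> (forall a, L (fun x => dot a x ^+ m) = 0) ->
  forall s k, (size s + k.*2)%N = m -> L (form_prod s) = 0.
Proof.
move=> fL L0 s k; elim: k => [|k IHk] in s *.
  by rewrite addn0; exact: functional_polarization.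
move=> sk; rewrite functional_raise//; apply: big1 => i _; apply: IHk.
by rewrite -sk /= doubleS !addSn !addnS.
Qed.

(** [c2 L1 - c1 L2] kills all powers of exponent [2t], hence also the constant
    1, where its value is [c2 - c1].  So [c1 = c2], and then [L1 - L2] kills
    the powers of exponents [2t] and [2t + 1], which covers both parities. *)
Lemma functional_unique n t (L1 L2 : ('rV[R]_n -> R) -> R) c1 c2 :
  sphere_functional L1 -> sphere_functional L2 ->
  L1 (fun=> 1) = 1 -> L2 (fun=> 1) = 1 ->
  (forall a, L1 (fun x => dot a x ^+ t.*2) = c1 * enorm a ^+ t.*2) ->
  (forall a, L2 (fun x => dot a x ^+ t.*2) = c2 * enorm a ^+ t.*2) ->
  (forall a, L1 (fun x => dot a x ^+ t.*2.+1) = 0) ->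
  (forall a, L2 (fun x => dot a x ^+ t.*2.+1) = 0) ->
  forall s, (size s <= t.*2.+1)%N -> L1 (form_prod s) = L2 (form_prod s).
Proof.
move=> fL1 fL2 L11 L21 L1e L2e L1o L2o.
have one : @form_prod R n [::] = fun=> 1 by apply/funext => x; exact: big_nil.
have c12 : c1 = c2.
  have fM := functional_lin c2 (- c1) fL1 fL2.
  have : c2 * L1 (form_prod [::]) + - c1 * L2 (form_prod [::]) = 0.
    apply: (functional_vanish fM _ (k := t) (m := t.*2)) => // a.
    by rewrite L1e L2e; ring.
  by rewrite one L11 L21 => ?; lra.
(* The degree of s has the parity of one of the two exponents. *)
have fM := functional_lin 1 (- 1) fL1 fL2.
move=> s st; apply/eqP; rewrite -subr_eq0 -[L1 _]mul1r -mulN1r; apply/eqP.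
have [odds|evens] := boolP (odd (size s)).
  apply: (functional_vanish fM (m := t.*2.+1) _ (k := (t.*2.+1 - size s)./2)).
    by move=> a; rewrite L1o L2o; ring.
  by rewrite even_halfK ?subnKC// oddB// odds /= odd_double.
have st2 : (size s <= t.*2)%N.
  by move: st; rewrite leq_eqVlt => /predU1P[e|//]; rewrite e /= odd_double in evens.
apply: (functional_vanish fM (m := t.*2) _ (k := (t.*2 - size s)./2)).
  by move=> a; rewrite L1e L2e c12; ring.
by rewrite even_halfK ?subnKC// oddB// (negPf evens) odd_double.
Qed.
End functional.

(** * Polynomials as combinations of products of linear forms *)

Section polynomials.
Context {R : realType}.

Definition linear_mpoly n (a : 'rV[R]_n) : mpoly.mpoly n R :=
  \sum_(i < n) a 0 i *: mpoly.mpolyX R (mpoly.mnm1 i).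

Lemma peval_linear n (a x : 'rV[R]_n) : peval (linear_mpoly a) x = dot a x.
Proof.
rewrite /peval /dot /linear_mpoly raddf_sum. apply: eq_bigr => i _ /=.
by rewrite mpoly.mevalZ mpoly.mevalXU.
Qed.

Lemma msize_linear n (a : 'rV[R]_n) : (mpoly.msize (linear_mpoly a) <= 2)%N.
Proof.
apply: leq_trans (mpoly.mmeasure_sum _ _ _ _) _.
apply/bigmax_leqP => i _; apply: leq_trans (mpoly.mmeasureZ_le _ _ _) _.
by rewrite mpoly.mmeasureX /= mpoly.mdeg1.
Qed.

Lemma form_prod_peval n (s : seq 'rV[R]_n) :
  exists2 p : mpoly.mpoly n R, (mpoly.msize p <= (size s).+1)%N
    & forall x, peval p x = form_prod s x.
Proof.
elim: s => [|a s [p ps pE]].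
  exists 1; first by rewrite mpoly.msize1.
  by move=> x; rewrite /peval mpoly.meval1 /form_prod big_nil.
exists (linear_mpoly a * p); last first.
  move=> x; rewrite /peval mpoly.mevalM -/(peval _ x) -/(peval p x).
  by rewrite peval_linear pE form_prod_cons.
have [->|a0] := eqVneq (linear_mpoly a) 0; first by rewrite mul0r mpoly.mmeasure0.
have [->|p0] := eqVneq p 0; first by rewrite mulr0 mpoly.mmeasure0.
rewrite mpoly.msizeM//= -ltnS prednK.
  by rewrite -addn2 addnC leq_add ?msize_linear.
by rewrite addn_gt0 lt0n mpoly.mmeasure_poly_eq0 a0.
Qed.

(** The coordinate forms of a monomial, repeated according to its exponents. *)
Definition mnm_forms n (m : mpoly.multinom n) : seq 'rV[R]_n :=
  flatten [seq nseq (m i) (delta_mx 0 i) | i : 'I_n].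

Lemma size_mnm_forms n (m : mpoly.multinom n) : size (mnm_forms m) = mpoly.mdeg m.
Proof.
rewrite size_flatten /shape -map_comp sumnE big_map mpoly.mdegE.
by rewrite big_enum; apply: eq_bigr => i _; rewrite /= size_nseq.
Qed.

Lemma peval_form_comb n (p : mpoly.mpoly n R) x :
  peval p x = form_comb [seq (mpoly.mcoeff m p, mnm_forms m) | m <- mpoly.msupp p] x.
Proof.
rewrite /peval mpoly.mevalE /form_comb [RHS]big_map; apply: eq_bigr => m _ /=.
congr (_ * _); rewrite /form_prod big_flatten big_image /=.
apply: eq_bigr => i _; rewrite -/(form_prod _ x) form_prod_nseq.
by rewrite dot_delta.
Qed.
End polynomials.

(** * Designs and isometric embeddings *)

Section designs.
Context {R : realType}.

(** Products of at most [r] linear forms are polynomials of degree at most [r],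
    and they span these polynomials. *)
Lemma weighted_designP n r (X : {fset 'rV[R]_n}) w :
  (forall x, x \in X -> enorm x = 1) -> (forall x, x \in X -> 0 < w x) ->
  weighted_design r X w <->
  forall s, (size s <= r)%N -> sphere_integral (form_prod s) =
     (\sum_(x <- X) w x)^-1 * \sum_(x <- X) w x * form_prod s x.
Proof.
move=> X1 w0; split=> [[_ _ Xr] s sr|Xr].
  have [p ps pE] := form_prod_peval s.
  have := Xr p; rewrite (leq_trans ps)// => /(_ isT) H.
  transitivity (\int[sphere_measure R n]_(u in unit_sphere R n) peval p (row_of_tuple u)).
    by apply: eq_Rintegral => u _; rewrite pE.
  by rewrite H; congr (_ * _); apply: eq_bigr => x _; rewrite pE.
split=> // p pr.
pose P := [seq (mpoly.mcoeff m p, @mnm_forms R n m) | m <- mpoly.msupp p].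
transitivity (sphere_integral (form_comb P)).
  by apply: eq_Rintegral => u _; rewrite peval_form_comb.
rewrite sphere_integral_comb big_map.
under [X in _ * X]eq_bigr do rewrite peval_form_comb /form_comb big_map mulr_sumr.
rewrite exchange_big /= mulr_sumr; apply: eq_big_seq => m mp.
rewrite Xr; last first.
  by rewrite size_mnm_forms -ltnS; apply: leq_trans pr; exact: mpoly.msize_mdeg_lt.
rewrite mulrCA; congr (_ * _); rewrite mulr_sumr.
by apply: eq_bigr => x _; rewrite mulrCA.
Qed.

Section isometry.
Context n k (phi : 'Hom('rV[R]_k, 'rV[R]_n)).
Hypothesis phi1 : forall x, enorm (phi x) = enorm x.

Lemma hom_isometry_dot x y : dot (phi x) (phi y) = dot x y.
Proof.
have q z : dot (phi z) (phi z) = dot z z by rewrite -!sqr_enorm phi1.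
have := q (x + y); rewrite linearD /= !(dotDl, dotDr) !q (dotC (phi y) (phi x)) (dotC y x) => ?.
lra.
Qed.

Definition adjoint (a : 'rV[R]_n) : 'rV[R]_k := \row_i dot a (phi (delta_mx 0 i)).

Lemma dot_adjoint a y : dot a (phi y) = dot (adjoint a) y.
Proof.
rewrite [in LHS](row_sum_delta y) linear_sum /=.
transitivity (\sum_j dot a (phi (y 0 j *: delta_mx 0 j))).
  elim/big_rec2: _ => [|j u v _ <-]; last by rewrite dotDr.
  by rewrite -(scale0r 0) dotZr mul0r.
by apply: eq_bigr => j _; rewrite linearZ dotZr mxE mulrC.
Qed.

(** [phi] composed with its adjoint is the projection onto its image, so
    [adjoint phi a] has the norm of the projection of [a]. *)
Lemma orth_projE a : orth_proj (limg phi) a = phi (adjoint a).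
Proof.
rewrite /orth_proj.
case: xgetP => [y -> [/memv_imgP[z _ yE] ay]|/(_ (phi (adjoint a)))]; last first.
  case; split; first by rewrite memv_img ?memvf.
  move=> v /memv_imgP[z _ ->].
  by rewrite dotBl dot_adjoint hom_isometry_dot subrr.
have H u : dot (z - adjoint a) u = 0.
  have := ay (phi u); rewrite memv_img ?memvf// => /(_ isT).
  rewrite yE !dotBl dot_adjoint hom_isometry_dot => ?; lra.
by rewrite yE; congr (phi _); apply/subr0_eq/dot_eq0/H.
Qed.

Lemma enorm_orth_proj a : enorm (orth_proj (limg phi) a) = enorm (adjoint a).
Proof. by rewrite orth_projE phi1. Qed.

Lemma form_prod_phi s y : form_prod s (phi y) = form_prod (map adjoint s) y.
Proof. by rewrite /form_prod big_map; apply: eq_bigr => a _; rewrite dot_adjoint. Qed.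
End isometry.
End designs.

Section functionals.
Context {R : realType}.

Lemma functional_pullback n k (phi : 'Hom('rV[R]_k, 'rV[R]_n)) L :
  (forall x, enorm (phi x) = enorm x) -> sphere_functional L ->
  sphere_functional (fun f => L (f \o phi)).
Proof.
move=> phi1 [combL eqL]; split=> [P|f g fg]; last first.
  by apply: eqL => x x1; apply: fg; rewrite phi1.
transitivity (L (form_comb [seq (m.1, map (adjoint phi) m.2) | m <- P])).
  by apply: eqL => x _; rewrite /form_comb big_map; apply: eq_bigr => m _;
     rewrite form_prod_phi.
rewrite combL big_map; apply: eq_bigr => m _; congr (_ * _).
by apply: eqL => x _ /=; rewrite form_prod_phi.
Qed.

Lemma functional_sum n (I : eqType) (r : seq I) (c : I -> R)
    (L : I -> ('rV[R]_n -> R) -> R) :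
  (forall i, i \in r -> sphere_functional (L i)) ->
  sphere_functional (fun f => \sum_(i <- r) c i * L i f).
Proof.
move=> fL; split=> [P|f g fg]; last first.
  by apply: eq_big_seq => i /fL[_ eqL]; rewrite (eqL _ _ fg).
under [RHS]eq_bigr do rewrite mulr_sumr.
rewrite exchange_big /=; apply: eq_big_seq => i /fL[-> _].
by rewrite mulr_sumr; apply: eq_bigr => m _; rewrite mulrCA.
Qed.

Lemma psumr_gt0_seq (I : eqType) (r : seq I) (P : pred I) (F : I -> R) i0 :
  (forall i, i \in r -> P i -> 0 < F i) -> i0 \in r -> P i0 ->
  0 < \sum_(i <- r | P i) F i.
Proof.
move=> F0 ri0 Pi0; rewrite lt0r big_seq_cond; apply/andP; split; last first.
  by apply: sumr_ge0 => i /andP[ri Pi]; exact/ltW/F0.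
rewrite psumr_eq0; last by move=> i /andP[ri Pi]; exact/ltW/F0.
apply/negP => /allP /(_ _ ri0); rewrite ri0 Pi0 /= => /eqP F0i0.
by have := F0 _ ri0 Pi0; rewrite F0i0 ltxx.
Qed.

(** The total mass is nonzero because, with [0^-1 = 0], exactness on the
    constant 1 would otherwise read [1 = 0]. *)
Lemma weighted_design_onP n k s (V : {vspace 'rV[R]_n}) (Y : {fset 'rV[R]_n}) w :
  weighted_design_on k.+1 s V Y w ->
  [/\ forall z, z \in Y -> enorm z = 1, forall z, z \in Y -> 0 < w z,
    \sum_(z <- Y) w z != 0 &
  exists phi : 'Hom('rV[R]_k.+1, 'rV[R]_n),
    [/\ limg phi = V, forall x, enorm (phi x) = enorm x
      & forall l, (size l <= s)%N -> \sum_(z <- Y) w z * form_prod l z =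
         (\sum_(z <- Y) w z) * sphere_integral (form_prod l \o phi)]].
Proof.
move=> [phi [phiV phi1 [X YE dX]]].
have [X1 w0 _] := dX.
have {dX} Xs := (weighted_designP s X1 w0).1 dX.
have phi_inj : injective phi.
  move=> x y xy; apply/subr0_eq/enorm_eq0.
  by rewrite -phi1 linearB /= xy subrr -(scale0r 0) enormZ normr0 mul0r.
have sumY (F : 'rV[R]_n -> R) : \sum_(z <- Y) F z = \sum_(x <- X) F (phi x).
  by rewrite YE big_imfset//= => x y _ _; exact: phi_inj.
have S0 : \sum_(x <- X) w (phi x) != 0.
  apply/eqP => S0; have := Xs [::] isT; rewrite S0 invr0 mul0r.
  rewrite (_ : form_prod [::] = fun=> 1); last by apply/funext => x; exact: big_nil.
  by rewrite sphere_integral1 => /eqP; rewrite oner_eq0.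
split.
- by move=> z; rewrite YE => /imfsetP[x /= xX ->]; rewrite phi1 X1.
- by move=> z; rewrite YE => /imfsetP[x /= xX ->]; exact: w0.
- by rewrite sumY.
exists phi; split=> // l ls; rewrite !sumY.
transitivity ((\sum_(x <- X) w (phi x)) *
    sphere_integral (form_prod (map (adjoint phi) l))); last first.
  by congr (_ * _); apply: eq_sphere_integral => x _ /=; rewrite form_prod_phi.
rewrite Xs ?size_map// mulVKf//.
by apply: eq_bigr => x _; rewrite form_prod_phi.
Qed.
End functionals.

(** * Gluing the designs along the frame *)

Theorem theorem3p2 (R : realType) (d k t s : nat)
    (hk : (1 <= k)%N) (hkd : (k <= d)%N) (ht : (1 <= t)%N) (hs : (1 <= s)%N)
    (D : {fset {vspace 'rV[R]_d}}) (omega : {vspace 'rV[R]_d} -> R)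
    (hD : forall V, V \in D -> \dim V = k)
    (hframe : tight_fusion_frame t D omega)
    (Y : {vspace 'rV[R]_d} -> {fset 'rV[R]_d})
    (lambda : {vspace 'rV[R]_d} -> 'rV[R]_d -> R)
    (hY : forall V, V \in D -> weighted_design_on k s V (Y V) (lambda V))
    (Lambda : R)
    (hLambda : forall V, V \in D -> \sum_(z <- Y V) lambda V z = Lambda) :
  let Z : {fset 'rV[R]_d} := (\big[fsetU/fset0]_(V <- D) Y V)%fset in
  let w (z : 'rV[R]_d) : R :=
    \sum_(V <- D | z \in Y V) omega V * lambda V z in
  weighted_design (minn s (2 * t + 1)) Z w.
Proof.
move=> Z w.
case: k hk => // k _ in hkd hD hY *.
case: d hkd => // n _ in D omega hD hframe Y lambda hY hLambda Z w *.
have {}hY V VD := weighted_design_onP (hY V VD).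
pose phi_spec V (phi : 'Hom('rV[R]_k.+1, 'rV[R]_n.+1)) := [/\ limg phi = V,
    forall x, enorm (phi x) = enorm x
  & forall l, (size l <= s)%N -> \sum_(z <- Y V) lambda V z * form_prod l z =
      Lambda * sphere_integral (form_prod l \o phi)].
have /boolp.choice[phi phiP] : forall V, exists f, V \in D -> phi_spec V f.
  move=> V.
  have [VD|VD] := boolP (V \in D); last by exists 0.
  have [_ _ _ [f [fV f1 fP]]] := hY _ VD.
  by exists f => _; split=> // l /fP ->; rewrite hLambda.
have [omega0 [A A0 frame]] := hframe.
have mul2t : (2 * t)%N = t.*2 by rewrite mul2n.
have [a a1] : exists a : 'rV[R]_n.+1, enorm a = 1.
  by exists (delta_mx 0 ord0); apply/enorm_eq1; rewrite dot_delta mxE !eqxx.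
(* Over an empty D the frame constant would be 0. *)
have [V0 V0D] : exists V0, V0 \in D.
  have [D0|//] := fset_0Vmem D; last by case=> V VD; exists V.
  have := frame a; rewrite D0 big_seq_fset0 a1 expr1n mulr1 => A0'.
  by move: A0; rewrite -A0' ltxx.
pose Omega := \sum_(V <- D) omega V.
have Omega0 : Omega != 0.
  by rewrite gt_eqF//; apply: psumr_gt0_seq V0D _ => // V VD _; exact: omega0.
have Lambda0 : Lambda != 0.
  by have [_ _ + _] := hY _ V0D; rewrite hLambda.
pose L (f : 'rV[R]_n.+1 -> R) :=
  \sum_(V <- D) Omega^-1 * omega V * sphere_integral (f \o phi V).
have fL : sphere_functional L.
  apply: (@functional_sum _ _ _ _ _ (fun V f => sphere_integral (f \o phi V))) => V VD.
  have [_ phi1 _] := phiP _ VD.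
  exact: functional_pullback phi1 (sphere_integral_functional _).
have Lpow m c :
    (forall b, sphere_integral (fun y : 'rV[R]_k.+1 => dot b y ^+ m) =
      c * enorm b ^+ m) ->
    forall b, L (fun x => dot b x ^+ m) =
      c * Omega^-1 * \sum_(V <- D) omega V * enorm (orth_proj V b) ^+ m.
  move=> cE b; rewrite mulr_sumr; apply: eq_big_seq => V VD.
  have [phiV phi1 _] := phiP _ VD.
  rewrite -[in orth_proj V b]phiV enorm_orth_proj//.
  transitivity (Omega^-1 * omega V * (c * enorm (adjoint (phi V) b) ^+ m)); last by ring.
  rewrite -cE; congr (_ * _); apply: eq_sphere_integral => y _ /=.
  by rewrite dot_adjoint.
have one : L (fun=> 1) = 1.
  transitivity (\sum_(V <- D) Omega^-1 * omega V).
    by apply: eq_bigr => V _; rewrite [sphere_integral _]sphere_integral1 mulr1.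
  by rewrite -mulr_sumr mulVf.
have key l : (size l <= t.*2.+1)%N -> sphere_integral (form_prod l) = L (form_prod l).
  have [c cE] := @sphere_integral_pow R k t.*2.
  have [c' cE'] := @sphere_integral_pow R n t.*2.
  apply: (functional_unique (c1 := c') (c2 := c * Omega^-1 * A)) => //.
  - exact: sphere_integral_functional.
  - exact: sphere_integral1.
  - by move=> b; rewrite (Lpow _ _ cE) -mul2t frame mulrA.
  - by move=> b; apply: sphere_integral_odd; rewrite /= odd_double.
  - move=> b; rewrite (Lpow _ 0) ?mul0r// => b'.
    by rewrite mul0r sphere_integral_odd//= odd_double.
have sumZ (g : 'rV[R]_n.+1 -> R) : \sum_(z <- Z) w z * g z =
    \sum_(V <- D) omega V * \sum_(z <- Y V) lambda V z * g z.
  under eq_bigr do rewrite mulr_suml big_mkcond.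
  rewrite exchange_big /=; apply: eq_big_seq => V VD.
  rewrite -big_mkcond /= mulr_sumr.
  have -> : \sum_(z <- Y V) omega V * (lambda V z * g z) =
      \sum_(z <- [seq z <- Z | z \in Y V]) omega V * (lambda V z * g z).
    apply: perm_big; apply: uniq_perm; rewrite ?filter_uniq ?fset_uniq// => z.
    rewrite mem_filter; have [zY|//] := boolP (z \in Y V).
    by apply/esym/bigfcupP; exists V; rewrite // VD.
  by rewrite big_filter; apply: eq_bigr => z _; rewrite mulrA.
have ZP z : z \in Z -> exists2 V, V \in D & z \in Y V.
  by move=> /bigfcupP[V /andP[VD _] zV]; exists V.
apply/weighted_designP.
- by move=> z /ZP[V VD zV]; have [-> //] := hY _ VD.
- move=> z /ZP[V VD zV]; apply: psumr_gt0_seq VD zV => V' V'D zV'.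
  by have [_ l0 _ _] := hY _ V'D; rewrite mulr_gt0 ?omega0 ?l0.
move=> l; rewrite leq_min => /andP[ls lt2]; rewrite key; last first.
  by rewrite -mul2t -[(2 * t).+1]addn1.
have -> : \sum_(z <- Z) w z = Lambda * Omega.
  under eq_bigr do rewrite -[w _]mulr1.
  rewrite sumZ mulr_sumr; apply: eq_big_seq => V VD.
  by under eq_bigr do rewrite mulr1; rewrite hLambda// mulrC.
rewrite sumZ mulr_sumr; apply: eq_big_seq => V VD.
have [_ _ ->//] := phiP _ VD.
by field; rewrite Omega0.
Qed.
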